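(* (i) For every $\alpha\in(0,1]$, $\mathrm{ES}_\alpha$ (as a map $L^\infty\to\overline{\mathbb{R}}$) is quasi-convex, law invariant and satisfies $\mathrm{ES}_\alpha\ge\mathrm{VaR}_\alpha$ on $L^\infty$, and every quasi-convex, law-invariant $\rho:L^\infty\to\overline{\mathbb{R}}$ with $\rho(X)\ge\mathrm{VaR}_\alpha(X)$ for all $X\in L^\infty$ satisfies $\rho\ge\mathrm{ES}_\alpha$ on $L^\infty$; i.e. $$\mathrm{ES}_\alpha=\min\{\rho:L^\infty\to\overline{\mathbb{R}}\mid \rho\ge\mathrm{VaR}_\alpha \text{ and } \rho \text{ is quasi-convex and law invariant}\}.$$ (ii) For every $\alpha\in[0,1)$, $$\mathrm{ES}_\alpha=\min\{\rho:L^\infty\to\overline{\mathbb{R}}\mid \rho\ge\mathrm{VaR}^+_\alpha \text{ and } \rho \text{ is quasi-convex and law invariant}\},$$ in the same sense.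
   Context: $(\Omega,\mathcal F,\mathbb P)$ is an atomless probability space, $L^0$ the set of all random variables, $L^\infty$ the essentially bounded ones, $\overline{\mathbb{R}}=[-\infty,\infty]$. For $\alpha\in[0,1]$ and $X\in L^0$: $\mathrm{VaR}_\alpha(X)=\inf\{x\in\mathbb{R}:\mathbb P(X\le x)\ge\alpha\}$, $\mathrm{VaR}^+_\alpha(X)=\inf\{x\in\mathbb{R}:\mathbb P(X\le x)>\alpha\}$ (with $\inf\mathbb{R}=-\infty$, $\inf\emptyset=\infty$; $\mathrm{VaR}_1$ is the essential supremum and $\mathrm{VaR}^+_0$ the essential infimum). For $X\in L^\infty$: $\mathrm{ES}_\alpha(X)=\frac{1}{1-\alpha}\int_\alpha^1\mathrm{VaR}_\beta(X)\,\mathrm d\beta$ for $\alpha\in[0,1)$ and $\mathrm{ES}_1(X)=\mathrm{VaR}_1(X)$. A map $\rho:L^\infty\to\overline{\mathbb{R}}$ is quasi-convex if $\rho(\gamma X+(1-\gamma)Y)\le\max\{\rho(X),\rho(Y)\}$ for all $X,Y\in L^\infty$, $\gamma\in[0,1]$, and law invariant if $\rho(X)=\rho(Y)$ whenever $X,Y$ have the same distribution. $\rho\ge\widetilde\rho$ means $\rho(X)\ge\widetilde\rho(X)$ for all $X$ in the common domain; ''min'' of a set of maps means an element of the set that is pointwise $\le$ every element. *)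

(* Defs.v *)
From HB Require Import structures.
From mathcomp Require Import all_boot all_order all_algebra.
From mathcomp Require Import all_classical all_reals all_analysis.
Set Implicit Arguments. Unset Strict Implicit. Unset Printing Implicit Defensive.
Import Order.TTheory GRing.Theory Num.Theory.
Local Open Scope classical_set_scope.
Local Open Scope ring_scope.
Local Open Scope ereal_scope.

Section Defs.
Context (R : realType) (d : measure_display) (T : measurableType d)
  (P : probability T R).

Definition atomless : Prop :=
  forall A : set T, measurable A -> 0 < P A ->
    exists B : set T, [/\ measurable B, B `<=` A, 0 < P B & P B < P A].

Definition Linf (X : T -> R) : Prop :=
  measurable_fun setT X /\ exists M : R, {ae P, forall t, (`|X t| <= M)%R}.

Definition same_law (X Y : T -> R) : Prop :=
  forall B : set R, measurable B -> P (X @^-1` B) = P (Y @^-1` B).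

(* VaR_a(X) = inf { x in R | P(X <= x) >= a }, inf R = -oo, inf empty = +oo *)
Definition VaR (a : R) (X : T -> R) : \bar R :=
  ereal_inf [set x%:E | x in [set x : R | a%:E <= P [set t | (X t <= x)%R]]].

Definition VaRp (a : R) (X : T -> R) : \bar R :=
  ereal_inf [set x%:E | x in [set x : R | a%:E < P [set t | (X t <= x)%R]]].

Definition ES (a : R) (X : T -> R) : \bar R :=
  if (a < 1)%R then
    ((1 - a)^-1)%:E * \int[@lebesgue_measure R]_(b in `[a, 1%R]) VaR b X
  else VaR 1 X.

Definition quasi_convex (rho : (T -> R) -> \bar R) : Prop :=
  forall (X Y : T -> R) (g : R), Linf X -> Linf Y -> (0 <= g <= 1)%R ->
    rho (fun t => g * X t + (1 - g) * Y t)%R <= maxe (rho X) (rho Y).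

Definition law_invariant (rho : (T -> R) -> \bar R) : Prop :=
  forall X Y : T -> R, Linf X -> Linf Y -> same_law X Y -> rho X = rho Y.

Definition ge_on_Linf (rho rho' : (T -> R) -> \bar R) : Prop :=
  forall X, Linf X -> rho' X <= rho X.

Definition is_min_QLI_above (lb m : (T -> R) -> \bar R) : Prop :=
  (ge_on_Linf m lb /\ quasi_convex m /\ law_invariant m) /\
  (forall rho, ge_on_Linf rho lb -> quasi_convex rho -> law_invariant rho ->
     ge_on_Linf rho m).

End Defs.

(* Main.v *)
Require Import Defs.
From HB Require Import structures.
From mathcomp Require Import all_boot all_order all_algebra.
From mathcomp Require Import all_classical all_reals all_analysis.
From mathcomp Require Import measurable_realfun ring lra zify.
Set Implicit Arguments. Unset Strict Implicit. Unset Printing Implicit Defensive.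
Import Order.TTheory GRing.Theory Num.Theory.
Import numFieldNormedType.Exports.
Local Open Scope classical_set_scope.
Local Open Scope ring_scope.

(** [ES_a] is quasi-convex (even convex for [a < 1]) by the Rockafellar-Uryasev
    formula [(1 - a) ES_a(X) = min_x ((1 - a) x + E[(X - x)^+])].

    For minimality above [VaRp_a], write [X ~ Q(U)] with [Q] the quantile
    function of [X] and [U] uniform; such a [U] exists because [P] is atomless
    (Sierpinski). Rotating the tail [(a, 1]] cyclically by [i (1 - a) / n], for
    [i < n], preserves the uniform law and produces [n] copies [Y_i] of [X]
    whose average is, on the whole event [U > a], a Riemann sum of [Q] over
    [(a, 1]], hence at least [ES_a(X) - O(1/n)]. Since [P(U <= a) = a], so is
    [VaRp_a] of the average, and therefore
    [ES_a(X) - O(1/n) <= rho (average Y_i) <= max_i rho(Y_i) = rho(X)].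

    The case of [VaR_a] follows from [VaR_a >= VaRp_b] for [b < a] and the left
    continuity of [b |-> ES_b(X)]. *)

(** * Atomless spaces carry a uniform random variable *)

Section real_probability.
Context (R : realType) (d : measure_display) (T : measurableType d)
  (P : probability T R).
Implicit Types A B : set T.

Definition pr A : R := fine (P A).

Lemma prE A : measurable A -> P A = (pr A)%:E.
Proof. by move=> mA; rewrite /pr fineK// fin_num_measure. Qed.

Lemma pr_ge0 A : 0 <= pr A.
Proof. by rewrite fine_ge0. Qed.

Lemma pr0 : pr set0 = 0.
Proof. by rewrite /pr measure0. Qed.

Lemma prT : pr setT = 1.
Proof. by rewrite /pr probability_setT. Qed.

Lemma prS A B : measurable A -> measurable B -> A `<=` B -> pr A <= pr B.
Proof.
move=> mA mB AB; rewrite fine_le ?fin_num_measure//.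
by apply: le_measure => //; rewrite inE.
Qed.

Lemma pr_le1 A : measurable A -> pr A <= 1.
Proof. by move=> mA; rewrite -prT prS. Qed.

Lemma prU A B : measurable A -> measurable B -> A `&` B = set0 ->
  pr (A `|` B) = pr A + pr B.
Proof. by move=> mA mB AB0; rewrite /pr measureU// fineD// fin_num_measure. Qed.

Lemma prD A B : measurable A -> measurable B -> B `<=` A ->
  pr (A `\` B) = pr A - pr B.
Proof.
move=> mA mB BA; have -> : pr A = pr (B `|` A `\` B) by rewrite setDUK.
rewrite prU ?setDIK//; last exact: measurableD.
by rewrite [X in _ = X - _]addrC addrK.
Qed.

Lemma pr_bigcup_le (F : (set T)^nat) (c : R) : (forall n, measurable (F n)) ->
  nondecreasing_seq F -> (forall n, pr (F n) <= c) -> pr (\bigcup_n F n) <= c.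
Proof.
move=> mF ndF Fc.
have mU : measurable (\bigcup_n F n) by exact: bigcup_measurable.
have cvF := nondecreasing_cvg_mu (mu := P) mF mU ndF.
rewrite -lee_fin -prE// -(cvg_lim (@ereal_hausdorff R) cvF) lime_le//.
  by apply/cvg_ex; eexists; exact: cvF.
by apply: nearW => n /=; rewrite prE// lee_fin.
Qed.

End real_probability.

Lemma measurable_fun_le_preimage (R : realType) (d : measure_display)
    (T : measurableType d) (f : T -> R) :
  (forall x, measurable [set t | f t <= x]) -> measurable_fun setT f.
Proof.
move=> mf; apply: (measurability (@RGenOInfty.G R)).
  exact: RGenOInfty.measurableE.
move=> /= _ [_ [x ->] <-]; rewrite setTI.
rewrite (_ : _ @^-1` _ = ~` [set t | f t <= x]); first exact: measurableC.
by apply/seteqP; split=> t /=; rewrite in_itv/= andbT ltNge => /negP.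
Qed.

Lemma measurable_le_preimage (R : realType) (d : measure_display)
    (T : measurableType d) (f : T -> R) x :
  measurable_fun setT f -> measurable [set t | f t <= x].
Proof.
move=> mf; rewrite (_ : [set _ | _] = setT `&` f @^-1` `]-oo, x]%classic).
  exact: mf.
by rewrite setTI; apply/seteqP; split=> t /=; rewrite in_itv.
Qed.

Section atomless.
Context (R : realType) (d : measure_display) (T : measurableType d)
  (P : probability T R) (hP : atomless P).
Local Notation pr := (pr P).

(** A proper part of positive mass and its complement cannot both exceed half of the mass, so
    keeping the smaller one halves it; after [n] rounds the mass is at most [2^-1 ^+ n]. *)
Lemma atomless_small_subset (A : set T) (e : R) : measurable A -> 0 < pr A ->
  0 < e -> exists B, [/\ measurable B, B `<=` A, 0 < pr B & pr B < e].
Proof.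
move=> mA A0 e0.
have [n ne] : exists n, (2^-1 : R) ^+ n < e.
  have : (2^-1 : R) ^+ n @[n --> \oo] --> 0.
    by apply: cvg_expr; rewrite ger0_norm ?invr_ge0// invf_lt1// ltr1n.
  move=> /cvgrPdist_lt /(_ _ e0)[n _] /(_ n (leqnn n)).
  by rewrite sub0r normrN ger0_norm ?exprn_ge0// => ?; exists n.
suff [B [mB BA B0 Bn]] : exists B, [/\ measurable B, B `<=` A, 0 < pr B &
    pr B <= 2^-1 ^+ n].
  by exists B; split => //; exact: le_lt_trans ne.
elim: n {ne} => [|n [B [mB BA B0 Bn]]].
  by exists A; split=> //; rewrite expr0 pr_le1.
have [|C [mC CB]] := hP mB; first by rewrite prE// lte_fin.
rewrite !prE// !lte_fin => C0 CltB.
have := prD P mB mC CB; rewrite exprS => BC.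
have [le|gt] := leP (pr C) (pr B / 2).
  by exists C; split=> //; [exact: subset_trans BA|lra].
exists (B `\` C); split; first exact: measurableD.
- by apply: subset_trans BA; exact: subDsetl.
- lra.
- lra.
Qed.

(* [B'] uses up at least half of the mass that can still be added to [B] without
   exceeding [c]; iterating must therefore exhaust [c]. *)
Let greedy_step (A : set T) (c : R) (B : set T) :
  measurable A -> measurable B -> B `<=` A -> pr B <= c ->
  exists B', [/\ measurable B', B' `<=` A, pr B' <= c, B `<=` B' &
    forall D, measurable D -> D `<=` A `\` B -> pr B + pr D <= c ->
      pr D <= 2 * (pr B' - pr B)].
Proof.
move=> mA mB BA Bc.
pose E := [set pr D | D in [set D | [/\ measurable D, D `<=` A `\` B &
  pr B + pr D <= c]]].
have E0 : E 0 by exists set0 => /=; rewrite pr0// addr0; split.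
have ubE : has_ubound E by exists 1 => _ [D [mD _ _] <-]; exact: pr_le1.
have [s0|s0] := leP (sup E) 0.
  exists B; split=> // D mD DA Dc; rewrite subrr mulr0 (le_trans _ s0)//.
  by apply: ub_le_sup => //; exists D.
have [] := @sup_adherent _ E (sup E / 2); first lra.
  by split => //; exists 0.
move=> _ [D [mD DA Dc] <-] hD.
have BD0 : B `&` D = set0.
  by apply/seteqP; split=> t // [Bt /DA[_]].
exists (B `|` D); split.
- exact: measurableU.
- by move=> t [/BA//|/DA[]].
- by rewrite prU.
- exact: subsetUl.
move=> D' mD' D'A D'c; rewrite prU// addrC addKr.
by have : pr D' <= sup E by [apply: ub_le_sup => //; exists D'|]; lra.
Qed.

(** Sierpinski's theorem. If the greedy union [C] had mass below [c], a small [D] in the rest of [A]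
    would stay admissible at every stage and force each step to gain at least [pr D / 2], which a
    bounded mass does not allow. *)
Lemma atomless_subset (A : set T) (c : R) : measurable A -> 0 <= c <= pr A ->
  exists B, [/\ measurable B, B `<=` A & pr B = c].
Proof.
move=> mA /andP[c0 cA].
pose ok B := [/\ measurable B, B `<=` A & pr B <= c].
have /choice[f Hf] : forall B, exists B', ok B -> [/\ ok B', B `<=` B' &
    forall D, measurable D -> D `<=` A `\` B -> pr B + pr D <= c ->
      pr D <= 2 * (pr B' - pr B)].
  move=> B; have [[mB BA Bc]|] := pselect (ok B); last by exists B.
  by have [B' [? ? ? ? ?]] := greedy_step mA mB BA Bc; exists B'.
pose F n := iter n f set0.
have okF n : ok (F n).
  elim: n => [|n /Hf[]//]; split=> //=; by rewrite pr0.
have mF n : measurable (F n) by case: (okF n).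
have subF n : F n `<=` F n.+1 by case: (Hf _ (okF n)).
have ndF : nondecreasing_seq F.
  by apply/nondecreasing_seqP => n; apply/subsetPset.
pose C := \bigcup_n F n.
have mC : measurable C by exact: bigcup_measurable.
have CA : C `<=` A by move=> t [n _]; case: (okF n) => _ + _; apply.
have Cc : pr C <= c by apply: pr_bigcup_le => // n; case: (okF n).
exists C; split=> //; apply/eqP; rewrite eq_le Cc/= leNgt; apply/negP => Cltc.
have AC := prD P mA mC CA.
have [| | |D [mD DAC D0 Dc]] := @atomless_small_subset (A `\` C) (c - pr C).
- exact: measurableD.
- lra.
- lra.
have FC n : pr (F n) <= pr C by apply: prS => //; exact: bigcup_sup.
have step n : pr (F n) + pr D / 2 <= pr (F n.+1).
  have [_ _ /(_ D mD)] := Hf _ (okF n).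
  have DAF : D `<=` A `\` F n.
    by move=> t /DAC[At nCt]; split=> // Ft; apply: nCt; exists n.
  by move=> /(_ DAF); have := FC n; lra.
have lowF n : n%:R * (pr D / 2) <= pr (F n).
  elim: n => [|n ih]; first by rewrite mul0r pr_ge0.
  by rewrite -natr1; have := step n; lra.
(* More than [(pr D / 2)^-1] steps would accumulate mass above 1. *)
have /archi_boundP : 0 <= (pr D / 2)^-1 by rewrite invr_ge0; lra.
set N := Num.bound _ => hN.
have := lowF N; have := FC N; have := pr_le1 P mC.
have : (pr D / 2)^-1 * (pr D / 2) < N%:R * (pr D / 2) by rewrite ltr_pM2r//; lra.
rewrite mulVf; last by rewrite gt_eqF//; lra.
lra.
Qed.

(** Repeated halving of the whole space yields, at depth [n], [2 ^ n] cells of equal mass; [U] reads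
    the nested cells around a point as binary digits. *)
Lemma atomless_uniform : exists U : T -> R, measurable_fun setT U /\
  forall c, 0 <= c <= 1 -> pr [set t | U t <= c] = c.
Proof.
have /choice[half Hhalf] : forall A, exists B, measurable A ->
    [/\ measurable B, B `<=` A & pr B = pr A / 2].
  move=> A; have [mA|] := pselect (measurable A); last by exists A.
  have [|B ?] := @atomless_subset A (pr A / 2) mA; last by exists B.
  by have := pr_ge0 P A; lra.
(* [K n t] is the integer whose binary digits record on which side of the first
   [n] successive halvings [t] lies. *)
pose K := fix K n (t : T) := if n is n'.+1 then
  ((K n' t).*2 + ~~ `[< half [set s | K n' s = K n' t] t >])%N else 0%N.
pose cell n k := [set t | K n t = k].
have cell2 n k : measurable (cell n k) -> cell n.+1 k.*2 = half (cell n k).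
  move=> /Hhalf[_ sub _]; apply/seteqP; split=> t /=.
    rewrite /cell/=; case: asboolP => /= [+ kk|_ kk]; last by lia.
    by have -> : K n t = k by lia.
  move=> ht; have Kk : K n t = k by exact: sub.
  by rewrite /cell/= Kk asboolT//= addn0.
have cell2S n k : measurable (cell n k) ->
    cell n.+1 k.*2.+1 = cell n k `\` half (cell n k).
  move=> /Hhalf[_ sub _]; apply/seteqP; split=> t /=.
    rewrite /cell/=; case: asboolP => /= [_ kk|+ kk]; first by lia.
    by have -> : K n t = k by lia.
  by rewrite /cell/= => -[->] nh; rewrite asboolF//= addn1.
have mcell n k : measurable (cell n k).
  elim: n k => [k|n ih k].
    have [->|k0] := eqVneq k 0%N.
      by rewrite (_ : cell _ _ = setT)//; apply/seteqP; split.
    rewrite (_ : cell _ _ = set0)//; apply/seteqP; split=> // t /= k0'.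
    by move: k0; rewrite -k0'.
  rewrite -(odd_double_half k); have [mh _ _] := Hhalf _ (ih k./2).
  case: (odd k); rewrite ?add0n ?add1n; last by rewrite cell2.
  by rewrite cell2S//; exact: measurableD.
have prcell n k : (k < 2 ^ n)%N -> pr (cell n k) = 2^-1 ^+ n.
  elim: n k => [[|//] _|n ih k kn].
    by rewrite expr0 -(prT P); congr pr; apply/seteqP; split.
  have [mh hs hE] := Hhalf _ (mcell n k./2).
  have k2 : (k./2 < 2 ^ n)%N by move: kn; rewrite expnS; lia.
  have {hE} := hE; rewrite (ih _ k2) => hE.
  rewrite -(odd_double_half k).
  case: (odd k); rewrite ?add0n ?add1n exprSr; last by rewrite cell2.
  by rewrite cell2S// prD// hE (ih _ k2); lra.
have mlow n k : measurable [set t | (K n t < k)%N].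
  rewrite (_ : [set _ | _] = \bigcup_(j in [set j | (j < k)%N]) cell n j).
    exact: bigcup_measurable.
  apply/seteqP; split=> [t tk|t [j jk kj]]; first by exists (K n t).
  by rewrite /= kj.
have prlow n k : (k <= 2 ^ n)%N -> pr [set t | (K n t < k)%N] = k%:R * 2^-1 ^+ n.
  elim: k => [_|k ih kn].
    by rewrite mul0r -(pr0 P); congr pr; apply/seteqP; split.
  rewrite (_ : [set _ | _] = [set t | (K n t < k)%N] `|` cell n k); last first.
    apply/seteqP; split=> t /=; rewrite /cell/=; last by lia.
    by move=> tk; have [?|?] := ltnP (K n t) k; [left|right; lia].
  rewrite prU// ?ih ?prcell ?(ltnW kn)//; first by rewrite -natr1; lra.
  by apply/seteqP; split=> t //= [+ kk]; rewrite kk ltnn.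
(* [u n t] and [v n t] are the endpoints of the dyadic interval selected at depth [n]. These
   intervals are nested, so the supremum [U t] of the left endpoints belongs to all of them. *)
pose u n t : R := (K n t)%:R * 2^-1 ^+ n.
pose v n t : R := (K n t)%:R * 2^-1 ^+ n + 2^-1 ^+ n.
have uS n t : u n t <= u n.+1 t.
  have : 0 < (2^-1 : R) ^+ n by rewrite exprn_gt0.
  rewrite /u exprS /= natrD -muln2 natrM; case: (~~ _) => /=; nra.
have vS n t : v n.+1 t <= v n t.
  have : 0 < (2^-1 : R) ^+ n by rewrite exprn_gt0.
  rewrite /v exprS /= natrD -muln2 natrM; case: (~~ _) => /=; nra.
have undx t : nondecreasing_seq (u^~ t) by apply/nondecreasing_seqP => n.
have vnix t : nonincreasing_seq (v^~ t) by apply/nonincreasing_seqP => n.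
have uv m n t : u m t <= v n t.
  have uv k : u k t <= v k t by rewrite lerDl exprn_ge0.
  have [mn|nm] := leqP m n; first by rewrite (le_trans (undx _ _ _ mn)).
  by rewrite (le_trans (uv m))//; exact/vnix/ltnW.
pose U t := sup (range (u^~ t)).
have ubu t : has_ubound (range (u^~ t)) by exists (v 0%N t) => _ [m _ <-].
have uU n t : u n t <= U t by apply: ub_le_sup => //; exists n.
have Uv n t : U t <= v n t.
  by apply: ge_sup; [exists (u 0%N t), 0%N|move=> _ [m _ <-]].
have mu n c : measurable [set t | u n t <= c].
  rewrite (_ : [set _ | _] =
    \bigcup_(j in [set j | j%:R * 2^-1 ^+ n <= c]) cell n j).
    exact: bigcup_measurable.
  apply/seteqP; split=> [t tk|t [j jk kj]]; first by exists (K n t).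
  by rewrite /= /u kj.
have mU c : measurable [set t | U t <= c].
  rewrite (_ : [set _ | _] = \bigcap_n [set t | u n t <= c]).
    exact: bigcap_measurable.
  apply/seteqP; split=> t /= => [Uc n _ /=|Hc]; first exact: le_trans Uc.
  by apply: ge_sup; [exists (u 0%N t), 0%N|move=> _ [m _ <-]; exact: Hc].
exists U; split; first exact: measurable_fun_le_preimage.
move=> c /andP[c0 c1].
have bound n : `|pr [set t | U t <= c] - c| <= 2^-1 ^+ n.
  have e0 : 0 < (2^-1 : R) ^+ n by rewrite exprn_gt0.
  have e1 : (2 ^ n)%:R * 2^-1 ^+ n = 1 :> R.
    by rewrite natrX -exprMn mulfV ?expr1n// pnatr_eq0.
  (* [k] locates [c] between consecutive multiples of [2^-1 ^+ n]. The event [U <= c] contains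
     [K n < k] and is contained in [K n < k + 1], which pins its mass to within [2^-1 ^+ n] of
     [c]. *)
  pose k := Num.trunc (c * (2 ^ n)%:R).
  have /truncn_itv/andP[] : 0 <= c * (2 ^ n)%:R by rewrite mulr_ge0.
  rewrite -/k => k1 k2.
  have {k1}kc : k%:R * 2^-1 ^+ n <= c.
    by move: k1; rewrite -(ler_pM2r e0 k%:R) -mulrA e1 mulr1.
  have {k2}ck : c < k.+1%:R * 2^-1 ^+ n.
    by move: k2; rewrite -(ltr_pM2r e0 _ k.+1%:R) -mulrA e1 mulr1.
  have kn : (k <= 2 ^ n)%N.
    by rewrite -(ler_nat R) -(ler_pM2r e0) e1 (le_trans kc).
  rewrite ler_distl; apply/andP; split.
    rewrite lerBlDr (le_trans (ltW ck))// -natr1 mulrDl mul1r lerD2r.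
    rewrite -prlow//; apply: prS => // t /= Kk; rewrite (le_trans (Uv n t))//.
    rewrite (le_trans _ kc)//.
    have : (K n t).+1%:R <= k%:R :> R by rewrite ler_nat.
    by rewrite -natr1 -(ler_pM2r e0 (_ + 1)) mulrDl mul1r.
  (* The count [prlow] covers at most [2 ^ n] cells; past that, [c] is at least 1 and the trivial
     bound on a probability suffices. *)
  have [kn'|nk] := leqP k.+1 (2 ^ n).
    rewrite (@le_trans _ _ (k.+1%:R * 2^-1 ^+ n))//; last by rewrite -natr1; lra.
    rewrite -prlow//; apply: prS => // t /= Uc.
    rewrite -(ltr_nat R) -(ltr_pM2r e0) (le_lt_trans _ ck)//.
    exact: le_trans (uU n t) Uc.
  have ck1 : 1 <= k%:R * (2^-1 : R) ^+ n.
    by move: nk; rewrite ltnS -(ler_nat R) -(ler_pM2r e0 (2 ^ n)%:R) e1.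
  by have := pr_le1 P (mU c); lra.
apply/eqP; rewrite -subr_eq0 -normr_eq0 eq_le normr_ge0 andbT leNgt.
apply/negP => h.
have : (2^-1 : R) ^+ n @[n --> \oo] --> 0.
  by apply: cvg_expr; rewrite ger0_norm ?invr_ge0// invf_lt1// ltr1n.
move=> /cvgrPdist_lt /(_ _ h)[n _] /(_ n (leqnn n)).
rewrite sub0r normrN ger0_norm ?exprn_ge0//.
by rewrite ltNge bound.
Qed.

End atomless.

(** * Laws and quantiles *)

Section equality_in_law.
Context (R : realType) (d d' : measure_display) (T : measurableType d)
  (T' : measurableType d') (P : probability T R) (P' : probability T' R).

(** Allows events to be compared on an almost sure event only, such as [X] being bounded by [M] or
    [U] being at most 1. *)
Lemma pr_eq_modulo (A B N : set T) : measurable A -> measurable B ->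
  measurable N -> pr P N = 1 -> A `&` N = B `&` N -> pr P A = pr P B.
Proof.
move=> mA mB mN N1 ABN.
suff prI C : measurable C -> pr P C = pr P (C `&` N).
  by rewrite (prI A)// ABN -prI.
move=> mC; rewrite -[in LHS](setUIDK C N) prU//; last 3 first.
- exact: measurableI.
- exact: measurableD.
- by apply/seteqP; split=> t //= [[_ ?] [_]].
suff -> : pr P (C `\` N) = 0 by rewrite addr0.
apply/eqP; rewrite eq_le pr_ge0 andbT.
have <- : pr P (setT `\` N) = 0 by rewrite prD// prT N1 subrr.
by apply: prS; [exact: measurableD|exact: measurableD|move=> t []].
Qed.

Context (X : T -> R) (Y : T' -> R) (mX : measurable_fun setT X)
  (mY : measurable_fun setT Y)
  (XY : forall x, pr P [set t | X t <= x] = pr P' [set t | Y t <= x]).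

Let X' : {mfun T >-> R} := HB.pack X (isMeasurableFun.Build _ _ _ _ X mX).
Let Y' : {mfun T' >-> R} := HB.pack Y (isMeasurableFun.Build _ _ _ _ Y mY).

(** The closed lower half-lines are stable under intersection, generate the Borel sets and exhaust
    the line, so distributions agreeing on them coincide. *)
Lemma eq_cdf_law (B : set R) : measurable B ->
  P (X @^-1` B) = P' (Y @^-1` B).
Proof.
pose G := [set `]-oo, x]%classic | x in [set: R]].
apply: (@measure_unique _ R _ G (fun n => `]-oo, n%:R]%classic) _ _ _ _
  (distribution P X') (distribution P' Y')).
- rewrite [LHS]RGenOInfty.measurableE; apply/seteqP; split.
    apply: smallest_sub; first exact: smallest_sigma_algebra.
    move=> _ [x ->]; rewrite -setCitvl -setTD.
    apply: sigma_algebraCD.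
    by apply: sub_sigma_algebra; exists x.
  apply: smallest_sub.
    by rewrite -RGenOInfty.measurableE; exact: sigma_algebra_measurable.
  move=> _ [x _ <-]; rewrite -RGenOInfty.measurableE.
  exact: measurable_itv.
- move=> _ _ [x _ <-] [y _ <-]; exists (Num.min x y) => //.
  by apply/seteqP; split=> t /=; rewrite !in_itv/= le_min => /andP.
- by move=> n; exists n%:R.
- apply/seteqP; split=> // t _; exists (Num.bound `|t|) => //=.
  by rewrite in_itv/= (le_trans (ler_norm _))// ltW// archi_boundP.
- move=> _ [x _ <-].
  transitivity (P [set t | X t <= x]).
    by congr (P _); apply/seteqP; split=> t /=; rewrite in_itv.
  transitivity (P' [set t | Y t <= x]).
    by rewrite !prE ?XY//; exact: measurable_le_preimage.
  by congr (P' _); apply/seteqP; split=> t /=; rewrite in_itv.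
- by move=> n; rewrite (le_lt_trans (probability_le1 _ _))// ltry.
Qed.

Lemma eq_cdf_integral (f : R -> \bar R) : measurable_fun setT f ->
  (forall x, 0 <= f x)%E ->
  (\int[P]_t f (X t) = \int[P']_t f (Y t))%E.
Proof.
move=> mf f0.
rewrite -[LHS](@ge0_integral_distribution _ _ _ _ _ P X' f mf f0).
rewrite -[RHS](@ge0_integral_distribution _ _ _ _ _ P' Y' f mf f0).
by apply: eq_measure_integral => B mB _; exact: eq_cdf_law.
Qed.

End equality_in_law.

Section quantile.
Context (R : realType) (d : measure_display) (T : measurableType d)
  (P : probability T R) (M : R) (X : T -> R).
Hypotheses (mX : measurable_fun setT X) (M0 : 0 <= M)
  (XM : pr P [set t | `|X t| <= M] = 1).
Local Notation F x := (pr P [set t | X t <= x]).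

Let mF x : measurable [set t | X t <= x].
Proof. exact: measurable_le_preimage. Qed.

Let F_nd x y : x <= y -> F x <= F y.
Proof. by move=> xy; apply: prS => // t /= Xx; exact: le_trans xy. Qed.

Let mN : measurable [set t | `|X t| <= M].
Proof.
apply: (@measurable_le_preimage _ _ _ (fun t => `|X t|)).
exact: measurableT_comp.
Qed.

Let F_ge x : M <= x -> F x = 1.
Proof.
move=> Mx; apply/eqP; rewrite eq_le pr_le1//= -XM prS// => t /=.
by move=> Xt; rewrite (le_trans (ler_norm _))// (le_trans Xt).
Qed.

Let F_lt x : x < - M -> F x = 0.
Proof.
move=> xM; rewrite -(pr0 P); apply: (pr_eq_modulo (N := [set t | `|X t| <= M])) => //.
rewrite set0I; apply/seteqP; split=> t //= [Xx]; rewrite ler_norml => /andP[].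
by rewrite leNgt (le_lt_trans Xx).
Qed.

(** Right continuity of the distribution function: the events [x + n.+1%:R^-1 < X t] have mass at
    most [1 - u] and increase to [x < X t]. *)
Let F_right u x : (forall e, 0 < e -> u <= F (x + e)) -> u <= F x.
Proof.
move=> ux; pose G n := [set t | x + n.+1%:R^-1 < X t].
have GE n : G n = setT `\` [set t | X t <= x + n.+1%:R^-1].
  apply/seteqP; (split=> t; rewrite /G/= ltNge).
    by move=> /negP.
  by case=> _ /negP.
have prGe y : pr P (setT `\` [set t | X t <= y]) = 1 - F y by rewrite prD// prT.
have : pr P (\bigcup_n G n) <= 1 - u.
  apply: pr_bigcup_le.
  - by move=> n; rewrite GE; exact: measurableD.
  - move=> m n mn; apply/subsetPset => t; rewrite /G/=; apply: le_lt_trans.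
    by rewrite lerD2l lef_pV2 ?posrE// ler_nat.
  - by move=> n; rewrite GE prGe lerD2l lerN2 ux.
rewrite (_ : \bigcup_n G n = setT `\` [set t | X t <= x]) ?prGe; first lra.
apply/seteqP; split=> t.
  move=> [n _]; rewrite /G/= => h; split=> //; apply/negP; rewrite -ltNge.
  by apply: lt_trans h; rewrite ltrDl.
by move=> [_ /negP]; rewrite -ltNge => /ltr_add_invr[k hk]; exists k.
Qed.

(* A real-valued version of [VaR] that is monotone and bounded on all of [R],
   including at the levels [u <= 0], where [VaR] is [-oo]. *)
Definition quantile (u : R) : R :=
  inf [set x | - M <= x /\ (u <= F x \/ M <= x)].
Local Notation Q := quantile.

Let SM u : [set x | - M <= x /\ (u <= F x \/ M <= x)] M.
Proof. by split; [rewrite ge0_cp|right]. Qed.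

Let Slb u : has_lbound [set x | - M <= x /\ (u <= F x \/ M <= x)].
Proof. by exists (- M) => x []. Qed.

Lemma quantile_le u : Q u <= M.
Proof. exact: ge_inf. Qed.

Lemma quantile_ge u : - M <= Q u.
Proof. by apply: lb_le_inf => [|x []//]; exists M. Qed.

Lemma quantile_nd u v : u <= v -> Q u <= Q v.
Proof.
move=> uv; apply: lb_le_inf; first by exists M.
move=> x /= [Mx ux]; apply: ge_inf => //; split=> //.
by case: ux => [vx|]; [left; exact: le_trans vx|right].
Qed.

(** By right continuity the infimum is attained. For [u <= 1] the alternative [M <= x] already gives
    [u <= F x], as [F] is 1 there; for [0 < u] the constraint [- M <= x] is automatic, as [F]
    vanishes below [- M]. *)
Lemma quantile_galois u x : 0 < u <= 1 -> (Q u <= x) = (u <= F x).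
Proof.
move=> /andP[u0 u1]; apply/idP/idP => h.
  apply: F_right => e e0.
  have [] := @inf_adherent _ [set x | - M <= x /\ (u <= F x \/ M <= x)] _ e0.
    by split=> //; exists M.
  move=> s [Ms us] sQ.
  have : F s <= F (x + e) by apply: F_nd; rewrite ltW// (lt_le_trans sQ)// lerD2r.
  by case: us => [|/F_ge->]; exact: le_trans.
apply: ge_inf => //; split; last by left.
by rewrite leNgt; apply/negP => /F_lt Fx; move: h u0; rewrite Fx; lra.
Qed.

Lemma VaR_quantile u : 0 < u <= 1 -> VaR P u X = (Q u)%:E.
Proof.
move=> u01; apply/eqP; rewrite eq_le; apply/andP; split.
  apply: ereal_inf_lbound; exists (Q u) => //=.
  by rewrite prE// lee_fin -quantile_galois.
apply: le_ereal_inf_tmp => _ [x /= + <-].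
by rewrite prE// !lee_fin quantile_galois.
Qed.

Lemma measurable_quantile (D : set R) : measurable D ->
  measurable_fun D Q.
Proof. by move=> mD; apply: nondecreasing_measurable => // u v; exact: quantile_nd. Qed.

Section uniform.
Context (d' : measure_display) (T' : measurableType d') (P' : probability T' R)
  (U : T' -> R) (mU : measurable_fun setT U)
  (U_unif : forall c, 0 <= c <= 1 -> pr P' [set t | U t <= c] = c).

(** The Galois relation turns [Q (U t) <= x] into [U t <= F x] on the almost sure event
    [0 < U t <= 1], and uniformity evaluates the latter. *)
Lemma quantile_cdf x : pr P' [set t | Q (U t) <= x] = F x.
Proof.
have mle c : measurable [set t | U t <= c] by exact: measurable_le_preimage.
rewrite -[RHS]U_unif ?pr_ge0 ?pr_le1//.
apply: (pr_eq_modulo (N := [set t | U t <= 1] `\` [set t | U t <= 0])) => //.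
- apply: (@measurable_le_preimage _ _ _ (Q \o U)).
  by apply: measurableT_comp => //; exact: measurable_quantile.
- exact: measurableD.
- rewrite prD// ?U_unif ?subr0//; try lra.
  by move=> t /= /le_trans; apply; rewrite ler01.
apply/seteqP; split=> t /= [h [U1 U0]]; move/negP: (U0); rewrite -ltNge => U0'.
  by rewrite -quantile_galois ?U0'.
by rewrite quantile_galois ?U0'.
Qed.

End uniform.

End quantile.

(** * Expected shortfall *)

Lemma bounded_fun_integrable (R : realType) (d : measure_display)
    (T : measurableType d) (mu : {measure set T -> \bar R}) (D : set T)
    (f : T -> R) (K : R) : measurable D -> (mu D < +oo)%E ->
  measurable_fun D f -> (forall x, `|f x| <= K) ->
  mu.-integrable D (EFin \o f).
Proof.
move=> mD Doo mf fK; apply: measurable_bounded_integrable => //.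
exists K; split; first exact: num_real.
by move=> N KN x _ /=; rewrite (le_trans (fK x))// ltW.
Qed.

Lemma ae_bounded_integrable (R : realType) (d : measure_display)
    (T : measurableType d) (P : probability T R) (f : T -> R) (K : R) :
  measurable_fun setT f -> 0 <= K -> pr P [set t | `|f t| <= K] = 1 ->
  P.-integrable setT (EFin \o f).
Proof.
move=> mf K0 fK; set N := [set t | `|f t| <= K].
have mN : measurable N.
  apply: (@measurable_le_preimage _ _ _ (fun t => `|f t|)).
  exact: measurableT_comp.
apply/integrableP; split; first exact/measurable_EFinP.
apply: (@le_lt_trans _ _ (\int[P]_t (K%:E))%E); last first.
  by rewrite integral_cst// lte_mul_pinfty// [ltLHS](probability_setT P) ltry.
apply: (@ae_ge0_le_integral _ _ _ P) => //.
- by apply: measurableT_comp => //; exact/measurable_EFinP.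
- exists (~` N); split; first exact: measurableC.
    rewrite -setTD [LHS](@prE _ _ _ P); last exact: measurableD.
    by rewrite prD// prT fK subrr.
  by move=> t /= h Nt; apply: h => _; rewrite lee_fin.
Qed.

Lemma lebesgue_itv_lty (R : realType) (a b : R) :
  (@lebesgue_measure R `]a, b] < +oo)%E.
Proof.
by rewrite lebesgue_measure_itv/=; case: ifPn => _; rewrite ?ltry// -EFinB ltry.
Qed.

Lemma fine_lebesgue_itv (R : realType) (a b : R) : a <= b ->
  fine (@lebesgue_measure R `]a, b]) = b - a.
Proof.
rewrite lebesgue_measure_itv/= lte_fin le_eqVlt => /orP[/eqP ->|->//].
by rewrite ltxx subrr.
Qed.

Lemma Linf_bound (R : realType) (d : measure_display) (T : measurableType d)
    (P : probability T R) (X : T -> R) : Linf P X ->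
  measurable_fun setT X /\ exists2 M, 0 <= M & pr P [set t | `|X t| <= M] = 1.
Proof.
move=> [mX [M [A [mA A0 XA]]]]; split=> //; exists `|M| => //.
have mN : measurable [set t | `|X t| <= `|M|].
  apply: (@measurable_le_preimage _ _ _ (fun t => `|X t|)).
  exact: measurableT_comp.
apply/eqP; rewrite eq_le pr_le1//=.
have <- : pr P (setT `\` A) = 1 by rewrite prD// prT /pr A0 subr0.
apply: prS => //; first exact: measurableD.
move=> t [_ At] /=; rewrite leNgt; apply/negP => h; apply: At.
by apply: XA => /=; apply/negP; rewrite -ltNge (le_lt_trans (ler_norm _)).
Qed.

Lemma measurable_excess (R : realType) (d : measure_display)
    (T : measurableType d) (D : set T) (f : T -> R) (x : R) :
  measurable D -> measurable_fun D f ->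
  measurable_fun D (fun t => Num.max (f t - x) 0).
Proof.
move=> mD mf; apply: measurable_maxr; last exact: measurable_cst.
exact: measurable_funB.
Qed.

Section expected_shortfall.
Context (R : realType) (d : measure_display) (T : measurableType d)
  (P : probability T R) (M : R).
Hypothesis M0 : 0 <= M.
Local Notation mu := (@lebesgue_measure R).

Section one_variable.
Context (X : T -> R).
Hypotheses (mX : measurable_fun setT X)
  (XM : pr P [set t | `|X t| <= M] = 1).
Local Notation Q := (quantile P M X).

Lemma quantile_norm u : `|Q u| <= M.
Proof. by rewrite ler_norml quantile_ge ?quantile_le. Qed.

Lemma integrable_quantile a : mu.-integrable `]a, 1] (EFin \o Q).
Proof.
apply: (@bounded_fun_integrable _ _ _ _ _ _ M) => //.
- exact: lebesgue_itv_lty.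
- exact: measurable_quantile.
- exact: quantile_norm.
Qed.

Lemma ES_quantile a : 0 <= a < 1 ->
  ES P a X = ((1 - a)^-1 * \int[mu]_(b in `]a, 1]) Q b)%:E.
Proof.
move=> /andP[a0 a1]; rewrite /ES a1 EFinM; congr (_ * _)%E.
have VQ b : b \in `]a, 1]%classic -> (Q b)%:E = VaR P b X.
  rewrite inE/= in_itv/= => /andP[ab b1].
  by rewrite (VaR_quantile mX M0 XM)// b1 (le_lt_trans a0).
(* The endpoint [a] is Lebesgue-null. Dropping it matters for [a = 0], where [VaR] is [-oo] and
   differs from [Q]. *)
rewrite -integral_itv_obnd_cbnd; last first.
  apply: (eq_measurable_fun (EFin \o Q)) => //.
  by apply/measurable_EFinP; exact: measurable_quantile.
under eq_integral do rewrite -VQ//.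
by rewrite /Rintegral fineK//; apply: integrable_fin_num; [|exact: integrable_quantile].
Qed.

(** Under the uniform law on the unit interval [Q] has the law of [X], so both sides integrate the
    same nonnegative function against the same distribution. *)
Lemma integral_quantile_excess x :
  \int[mu]_(u in `]0, 1]) Num.max (Q u - x) 0 = \int[P]_t Num.max (X t - x) 0.
Proof.
have mg : measurable_fun setT (fun y : R => (Num.max (y - x) 0)%:E).
  by apply/measurable_EFinP; apply: measurable_excess.
have g0 y : (0 <= (Num.max (y - x) 0)%:E)%E by rewrite lee_fin le_max lexx orbT.
rewrite /Rintegral; congr fine.
pose U : measurableTypeR R -> R := idfun.
have mU : measurable_fun setT U by exact: measurable_id.
pose P' : probability (measurableTypeR R) R := uniform_prob (@ltr01 R).
have U_unif c : 0 <= c <= 1 -> pr P' [set t | U t <= c] = c.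
  move=> /andP[c0 c1]; rewrite /pr.
  have -> : P' [set t | U t <= c] = mu `[0, c]; last first.
    rewrite lebesgue_measure_itv/= lte_fin; move: c0.
    by rewrite le_eqVlt => /orP[/eqP <-|->/=]; rewrite ?ltxx// subr0.
  rewrite /P'/= /uniform_prob integral_uniform_pdf.
  rewrite (_ : _ `&` _ = `[0, c]%classic); last first.
    apply/seteqP; (split=> t /=; rewrite !in_itv/=).
      by move=> [tc /andP[-> _]]; exact: tc.
    by move=> /andP[-> tc]; rewrite (le_trans tc).
  rewrite (eq_integral (fun=> 1%E)) ?integral_cst ?mul1e// => t.
  rewrite inE/= in_itv/= /uniform_pdf => /andP[-> tc].
  by rewrite (le_trans tc)// subr0 invr1.
have mQU : measurable_fun setT (Q \o U).
  by apply: measurableT_comp => //; exact: measurable_quantile.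
have h t : pr P [set s | X s <= t] = pr P' [set s | (Q \o U) s <= t].
  by rewrite (quantile_cdf mX M0 XM mU).
rewrite [RHS](eq_cdf_integral mX mQU h mg g0).
rewrite integral_uniform//=; last exact: (measurableT_comp mg mQU).
rewrite subr0 invr1 mul1e integral_itv_obnd_cbnd//.
apply: measurable_funTS; exact: (measurableT_comp mg mQU).
Qed.

Let int_const D (c : R) : measurable D -> (mu D < +oo)%E ->
  mu.-integrable D (EFin \o (fun=> c)).
Proof. by move=> mD Doo; apply: (@bounded_fun_integrable _ _ _ _ _ _ `|c|). Qed.

Let excess_norm (x y : R) : `|y| <= M -> `|Num.max (y - x) 0| <= M + `|x|.
Proof.
move=> yM.
rewrite ger0_norm; last by rewrite le_max lexx orbT.
rewrite ge_max addr_ge0// andbT (le_trans (ler_norm _))//.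
by rewrite (le_trans (ler_normB _ _))// lerD2r.
Qed.

Let integrable_excess_quantile a x :
  mu.-integrable `]a, 1] (EFin \o (fun u => Num.max (Q u - x) 0)).
Proof.
apply: (@bounded_fun_integrable _ _ _ _ _ _ (M + `|x|)) => //.
- exact: lebesgue_itv_lty.
- by apply: measurable_excess => //; exact: measurable_quantile.
- by move=> u; exact: (excess_norm _ (quantile_norm _)).
Qed.

Lemma integrable_excess x :
  P.-integrable setT (EFin \o (fun t => Num.max (X t - x) 0)).
Proof.
have mN : measurable [set t | `|X t| <= M].
  apply: (@measurable_le_preimage _ _ _ (fun t => `|X t|)).
  exact: measurableT_comp.
have mE : measurable_fun setT (fun t => Num.max (X t - x) 0) by exact: measurable_excess.
apply: (@ae_bounded_integrable _ _ _ _ _ (M + `|x|)) => //.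
  by rewrite addr_ge0.
have mN' : measurable [set t | `|Num.max (X t - x) 0| <= M + `|x|].
  apply: (@measurable_le_preimage _ _ _ (fun t => `|Num.max (X t - x) 0|)).
  exact: measurableT_comp.
by apply/eqP; rewrite eq_le pr_le1//= -XM prS// => t /= /excess_norm; apply.
Qed.

Let split_excess a x : 0 <= a < 1 ->
  \int[mu]_(u in `]0, 1]) Num.max (Q u - x) 0 =
  \int[mu]_(u in `]0, a]) Num.max (Q u - x) 0 +
  \int[mu]_(u in `]a, 1]) Num.max (Q u - x) 0.
Proof.
move=> /andP[a0 a1].
rewrite -(@Rintegral_itvB _ _ (BRight 0) (BRight 1) a).
- by rewrite addrC subrK.
- exact: integrable_excess_quantile.
- by rewrite bnd_simp.
- by rewrite bnd_simp ltW.
Qed.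

(** The inequality half of the Rockafellar-Uryasev formula, for an arbitrary level [x]: [Q u] is at
    most [x] plus its excess over [x], and the excess on []0, a]] is nonnegative. *)
Lemma tail_integral_le a x : 0 <= a < 1 ->
  \int[mu]_(u in `]a, 1]) Q u <=
  (1 - a) * x + \int[P]_t Num.max (X t - x) 0.
Proof.
move=> a01; have /andP[a0 a1] := a01.
rewrite -integral_quantile_excess (split_excess x a01).
have Doo := (lebesgue_itv_lty a 1).
have -> : (1 - a) * x = \int[mu]_(u in `]a, 1]) x.
  by rewrite Rintegral_cst// fine_lebesgue_itv ?ltW// mulrC.
rewrite addrCA -[leLHS]add0r lerD//.
  by apply: Rintegral_ge0 => u _; rewrite le_max lexx orbT.
rewrite -RintegralD//; last exact: int_const.
apply: le_Rintegral => //.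
- exact: integrable_quantile.
- exact: (integrableD _ (int_const x _ Doo) (integrable_excess_quantile a x)).
- by move=> u _; rewrite -lerBlDl le_max lexx.
Qed.

(** The level [Q a] is a minimizer: by monotonicity the excess over it vanishes on []0, a]] and
    equals [Q u - Q a] on []a, 1]]. *)
Lemma tail_integral_eq a : 0 <= a < 1 ->
  \int[mu]_(u in `]a, 1]) Q u =
  (1 - a) * Q a + \int[P]_t Num.max (X t - Q a) 0.
Proof.
move=> a01; have /andP[a0 a1] := a01.
rewrite -integral_quantile_excess (split_excess _ a01).
have Doo := (lebesgue_itv_lty a 1).
have -> : (1 - a) * Q a = \int[mu]_(u in `]a, 1]) Q a.
  by rewrite Rintegral_cst// fine_lebesgue_itv ?ltW// mulrC.
have -> : \int[mu]_(u in `]0, a]) Num.max (Q u - Q a) 0 = 0.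
  rewrite (eq_Rintegral _ (g := fun=> 0)); first by rewrite Rintegral_cst// mul0r.
  move=> u; rewrite inE/= in_itv/= => /andP[_ ua].
  by apply/max_idPr; rewrite subr_le0 quantile_nd.
rewrite add0r -RintegralD//; last exact: int_const.
apply: eq_Rintegral => u; rewrite inE/= in_itv/= => /andP[au _].
rewrite (max_idPl _) ?subr_ge0 ?quantile_nd// ?ltW//.
by rewrite addrC subrK.
Qed.

(** [VaRp] at level [a] lies below [VaR] at every level in []a, 1]], hence below the average of
    these values. *)
Lemma VaRp_le_ES a : 0 <= a < 1 -> (VaRp P a X <= ES P a X)%E.
Proof.
move=> a01; have /andP[a0 a1] := a01.
have VQ b : a < b <= 1 -> (VaRp P a X <= (Q b)%:E)%E.
  move=> /andP[ab b1]; rewrite -(VaR_quantile mX M0 XM)//; last first.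
    by rewrite b1 (le_lt_trans a0).
  apply: ereal_inf_le_tmp => _ [x /= bx <-]; exists x => //=.
  by rewrite (lt_le_trans _ bx)// lte_fin.
rewrite ES_quantile//.
(* [VaRp] may be [-oo], as the level 0 is not excluded from its own definition by finiteness; the
   value [+oo] is ruled out by comparison with [Q 1]. *)
move: VQ; case: (VaRp P a X) => [c| |] VQ; last by rewrite leNye.
  rewrite lee_fin mulrC ler_pdivlMr ?subr_gt0//.
  have Doo := (lebesgue_itv_lty a 1).
  have -> : c * (1 - a) = \int[mu]_(u in `]a, 1]) c.
    by rewrite Rintegral_cst// fine_lebesgue_itv ?ltW.
  apply: le_Rintegral => //; [exact: int_const|exact: integrable_quantile].
by have := VQ 1; rewrite a1 lexx => /(_ isT).
Qed.

End one_variable.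

Lemma ES_quasi_convex_bounded a (X Y : T -> R) (g : R) : 0 <= a <= 1 ->
  0 <= g <= 1 -> measurable_fun setT X -> measurable_fun setT Y ->
  pr P [set t | `|X t| <= M] = 1 -> pr P [set t | `|Y t| <= M] = 1 ->
  (ES P a (fun t => g * X t + (1 - g) * Y t)%R <=
   maxe (ES P a X) (ES P a Y))%E.
Proof.
move=> /andP[a0 a1] /andP[g0 g1] mX mY XM YM.
pose Z t := g * X t + (1 - g) * Y t; rewrite -[X in ES _ _ X]/Z.
have mZ : measurable_fun setT Z.
  by apply: measurable_funD; apply: measurable_funM => //; exact: measurable_cst.
have mabs (V : T -> R) : measurable_fun setT V -> measurable [set t | `|V t| <= M].
  move=> mV; apply: (@measurable_le_preimage _ _ _ (fun t => `|V t|)).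
  exact: measurableT_comp.
have prI (A B : set T) : measurable A -> measurable B -> pr P A = 1 ->
    pr P B = 1 -> pr P (A `&` B) = 1.
  move=> mA mB A1 B1; rewrite -A1.
  by apply: (pr_eq_modulo (N := B)) => //; [exact: measurableI|rewrite -setIA setIid].
have conv (x y c : R) : x <= c -> y <= c -> g * x + (1 - g) * y <= c by nra.
have ZM : pr P [set t | `|Z t| <= M] = 1.
  have mNZ := mabs _ mZ; apply/eqP; rewrite eq_le pr_le1//=.
  rewrite -(prI _ _ (mabs _ mX) (mabs _ mY) XM YM); apply: prS.
  - by apply: measurableI; exact: mabs.
  - exact: mNZ.
  - move=> t [] /=; rewrite !ler_norml /Z => /andP[? ?] /andP[? ?].
    by apply/andP; split; nra.
(* At level 1 the quantile is the essential supremum: both variables are almost surely at most [m],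
   hence so is their convex combination. *)
have [lt_a1|ge_a1] := ltP a 1; last first.
  have -> : a = 1 by apply/eqP; rewrite eq_le a1.
  rewrite /ES ltxx !(@VaR_quantile _ _ _ _ M)// ?ltr01 ?lexx//.
  rewrite -EFin_max lee_fin quantile_galois ?ltr01 ?lexx//.
  set m := Num.max _ _.
  have m1 (V : T -> R) : measurable_fun setT V ->
      pr P [set t | `|V t| <= M] = 1 -> quantile P M V 1 <= m ->
      pr P [set t | V t <= m] = 1.
    move=> mV VM; rewrite quantile_galois ?ltr01 ?lexx// => h.
    by apply/eqP; rewrite eq_le h pr_le1//; exact: measurable_le_preimage.
  have Xm : pr P [set t | X t <= m] = 1 by apply: m1 => //; rewrite le_max lexx.
  have Ym : pr P [set t | Y t <= m] = 1 by apply: m1 => //; rewrite le_max lexx orbT.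
  rewrite -(prI _ _ _ _ Xm Ym); try exact: measurable_le_preimage.
  apply: prS; first by apply: measurableI; exact: measurable_le_preimage.
    exact: measurable_le_preimage.
  by move=> t [/= ? ?]; exact: conv.
have a01 : 0 <= a < 1 by rewrite a0.
have c0 : 0 < (1 - a)^-1 by rewrite invr_gt0 subr_gt0.
rewrite !ES_quantile// -EFin_max lee_fin -(maxr_pMr _ _ (ltW c0)) ler_pM2l//.
pose es V := \int[mu]_(b in `]a, 1]) quantile P M V b.
suff : es Z <= g * es X + (1 - g) * es Y.
  by move/le_trans; apply; apply: conv; rewrite le_max lexx ?orbT.
rewrite /es (tail_integral_eq mX XM a01) (tail_integral_eq mY YM a01).
set x := quantile P M X a; set y := quantile P M Y a.
(* The minimizers for [X] and [Y] combine into a trial level for [Z]. It need not be a quantile of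
   [Z], but the inequality half of the formula accepts any level, which leaves only the convexity of
   the positive part. *)
rewrite (le_trans (tail_integral_le mZ ZM (g * x + (1 - g) * y) a01))//.
have iX := integrable_excess mX XM x; have iY := integrable_excess mY YM y.
have iZ := integrable_excess mZ ZM (g * x + (1 - g) * y).
suff : \int[P]_t Num.max (Z t - (g * x + (1 - g) * y)) 0 <=
    g * (\int[P]_t Num.max (X t - x) 0) + (1 - g) * (\int[P]_t Num.max (Y t - y) 0).
  by lra.
rewrite -!RintegralZl// -RintegralD//; last 2 first.
- exact: (integrableZl _ _ iX).
- exact: (integrableZl _ _ iY).
apply: le_Rintegral => //.
- exact: (integrableD _ (integrableZl _ g iX) (integrableZl _ (1 - g) iY)).
- move=> t _; rewrite /Z ge_max.
  have p (z : R) : 0 <= Num.max z 0 by rewrite le_max lexx orbT.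
  have q (z : R) : z <= Num.max z 0 by rewrite le_max lexx.
  have := p (X t - x); have := p (Y t - y).
  have := q (X t - x); have := q (Y t - y).
  by move=> ? ? ? ?; apply/andP; split; nra.
Qed.

End expected_shortfall.

Section expected_shortfall_properties.
Context (R : realType) (d : measure_display) (T : measurableType d)
  (P : probability T R).

Lemma VaR_le_VaRp a (X : T -> R) : (VaR P a X <= VaRp P a X)%E.
Proof.
by apply: ereal_inf_le_tmp => _ [x /= ax <-]; exists x => //=; exact: ltW.
Qed.

Lemma ES_ge_VaRp a : 0 <= a < 1 -> ge_on_Linf P (ES P a) (VaRp P a).
Proof.
move=> a01 X /Linf_bound[mX [M M0 XM]].
exact: (VaRp_le_ES M0 mX XM).
Qed.

Lemma ES_quasi_convex a : 0 <= a <= 1 -> quasi_convex P (ES P a).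
Proof.
move=> a01 X Y g /Linf_bound[mX [M1 M10 XM]] /Linf_bound[mY [M2 M20 YM]] g01.
have widen (V : T -> R) (M N : R) : measurable_fun setT V -> M <= N ->
    pr P [set t | `|V t| <= M] = 1 -> pr P [set t | `|V t| <= N] = 1.
  move=> mV MN VM.
  have mabs K : measurable [set t | `|V t| <= K].
    apply: (@measurable_le_preimage _ _ _ (fun t => `|V t|)).
    exact: measurableT_comp.
  by apply/eqP; rewrite eq_le pr_le1//= -VM prS// => t /= /le_trans; apply.
apply: (@ES_quasi_convex_bounded _ _ _ _ (M1 + M2)) => //; first exact: addr_ge0.
- by apply: (widen _ M1) => //; rewrite lerDl.
- by apply: (widen _ M2) => //; rewrite lerDr.
Qed.

Lemma ES_law_invariant a : law_invariant P (ES P a).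
Proof.
move=> X Y _ _ XY.
suff VE b : VaR P b X = VaR P b Y.
  by rewrite /ES VE; under eq_integral do rewrite VE.
rewrite /VaR; congr (ereal_inf (image _ _)); apply/funext => x /=.
have le_itv (V : T -> R) : [set t | V t <= x] = V @^-1` `]-oo, x]%classic.
  by apply/seteqP; split=> t /=; rewrite in_itv.
by rewrite !le_itv XY//; exact: measurable_itv.
Qed.

End expected_shortfall_properties.

(** * Minimality *)

Section quasi_convex_average.
Context (R : realType) (d : measure_display) (T : measurableType d)
  (P : probability T R).

Definition average (n : nat) (Y : nat -> T -> R) (t : T) : R :=
  n.+1%:R^-1 * \sum_(i < n.+1) Y i t.

(** Displays the average as a two-term convex combination in the exact shape required by
    [quasi_convex], so that quasi-convexity can be iterated. *)
Lemma averageS n Y : average n.+1 Y =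
  (fun t => (1 - n.+2%:R^-1) * average n Y t + (1 - (1 - n.+2%:R^-1)) * Y n.+1 t).
Proof.
apply/funext => t; rewrite /average big_ord_recr/= -[n.+2%:R]natr1.
have : 0 < n.+1%:R :> R by rewrite ltr0Sn.
move: n.+1%:R (\sum_(i < n.+1) _) => x S x0.
by field; apply/andP; split; rewrite gt_eqF//; lra.
Qed.

Lemma average_norm n Y K t : (forall i, `|Y i t| <= K) -> `|average n Y t| <= K.
Proof.
move=> YK; rewrite /average normrM ger0_norm ?invr_ge0//.
rewrite mulrC ler_pdivrMr ?ltr0Sn// (le_trans (ler_norm_sum _ _ _))//.
rewrite (@le_trans _ _ (\sum_(i < n.+1) K))//; first by apply: ler_sum.
by rewrite sumr_const card_ord mulr_natr.
Qed.

Lemma measurable_average n Y : (forall i, measurable_fun setT (Y i)) ->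
  measurable_fun setT (average n Y).
Proof.
move=> mY; apply: measurable_funM; first exact: measurable_cst.
by apply: measurable_sum => i.
Qed.

Lemma bounded_Linf (X : T -> R) (K : R) : measurable_fun setT X ->
  (forall t, `|X t| <= K) -> Linf P X.
Proof. by move=> mX XK; split=> //; exists K; exact: aeW. Qed.

(** Induction through [averageS]; the common bound [K] keeps every partial average in [Linf], where
    quasi-convexity applies. *)
Lemma quasi_convex_average (rho : (T -> R) -> \bar R) (K : R) r n
    (Y : nat -> T -> R) :
  quasi_convex P rho -> (forall i, measurable_fun setT (Y i)) ->
  (forall i t, `|Y i t| <= K) -> (forall i, (i <= n)%N -> (rho (Y i) <= r)%E) ->
  (rho (average n Y) <= r)%E.
Proof.
move=> qc mY YK; elim: n => [|n ih] Yr.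
  rewrite (_ : average 0 Y = Y 0%N) ?Yr//.
  by apply/funext => t; rewrite /average big_ord1 invr1 mul1r.
rewrite averageS (le_trans (qc _ _ _ _ _ _))//.
- apply: (@bounded_Linf _ K); first exact: measurable_average.
  by move=> t; exact: average_norm.
- exact: (@bounded_Linf _ K).
- rewrite subr_ge0 invf_le1 ?ltr0Sn// ler1n/= lerBlDr lerDl.
  by rewrite invr_ge0.
- by rewrite ge_max ih ?Yr// => i /leqW; exact: Yr.
Qed.

End quasi_convex_average.

(** * Rotations of the tail that preserve the uniform law *)

Section rotation.
Context (R : realType).

(* Cyclic translation by [s] of the interval [(a, 1]]; levels up to [a] are
   left fixed. *)
Definition rotation (a s u : R) : R :=
  if u <= a then u else if u <= 1 - s then u + s else u + s - (1 - a).

Lemma measurable_rotation a s : measurable_fun setT (rotation a s).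
Proof.
apply: measurable_fun_ifT => //; first exact: measurable_fun_ler.
apply: measurable_fun_ifT => //; first exact: measurable_fun_ler.
  exact: measurable_funD.
by apply: measurable_funB => //; exact: measurable_funD.
Qed.

(** On the almost sure event [U <= 1], the preimage of a lower half-line is an explicit union of
    intervals of total length [c]; its shape depends on where [c] lies relative to [a] and
    [a + s]. *)
Lemma rotation_uniform (d : measure_display) (T : measurableType d)
    (P : probability T R) (U : T -> R) (a s : R) :
  measurable_fun setT U ->
  (forall c, 0 <= c <= 1 -> pr P [set t | U t <= c] = c) ->
  0 <= a -> 0 <= s <= 1 - a ->
  forall c, 0 <= c <= 1 -> pr P [set t | rotation a s (U t) <= c] = c.
Proof.
move=> mU Uc a0 /andP[s0 s1] c /andP[c0 c1].
have mle x : measurable [set t | U t <= x] by exact: measurable_le_preimage.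
have mr : measurable [set t | rotation a s (U t) <= c].
  apply: measurable_le_preimage.
  by apply: measurableT_comp => //; exact: measurable_rotation.
have U1 : pr P [set t | U t <= 1] = 1 by rewrite Uc// ler01 lexx.
have prI x y : 0 <= x -> x <= y -> y <= 1 ->
    pr P ([set t | U t <= y] `\` [set t | U t <= x]) = y - x.
  move=> x0 xy y1; rewrite prD//; last by move=> t /= /le_trans; apply.
  by rewrite !Uc//; apply/andP; split; lra.
have [ca|ac] := leP c a.
  rewrite -[RHS]Uc ?c0//; apply: (pr_eq_modulo _ _ (mle 1) U1) => //.
  apply/seteqP; split=> t /= [+ tU]; rewrite /rotation;
    by do 2? case: ifPn; rewrite -2?ltNge => *; split => //; lra.
(* Between [a] and [a + s] only wrapped levels land: the fixed part contributes mass [a] and the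
   wrapped part [c - a]. *)
have [cs|sc] := leP c (a + s).
  pose B := [set t | U t <= a] `|`
    ([set t | U t <= c - s + (1 - a)] `\` [set t | U t <= 1 - s]).
  transitivity (pr P B); last first.
    rewrite /B prU//; last 2 first.
    - exact: measurableD.
    - by apply/seteqP; split=> t //= [Ua [_ /negP]]; rewrite -ltNge; lra.
    rewrite Uc; last by apply/andP; split; lra.
    by rewrite prI; lra.
  apply: (pr_eq_modulo _ _ (mle 1) U1) => //.
    by apply: measurableU => //; exact: measurableD.
  apply/seteqP; split=> t /=.
    rewrite /rotation => -[+ tU]; case: ifPn => [? ?|]; first by split=> //; left.
    rewrite -ltNge; case: ifPn => [*|]; first by lra.
    move=> /negP ns aU h; split=> //; right; split=> // /=; lra.
  rewrite /rotation => -[[/= Ua|[/= Uc1 /= Us]] tU]; split=> //.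
    by rewrite Ua (le_trans Ua)// ltW.
  move/negP: (Us); rewrite -ltNge => Us'.
  rewrite ifF; last by apply/negP; lra.
  by rewrite ifF; [lra|apply/negP].
(* Above [a + s] all wrapped levels, of mass [s], are included together with the unwrapped ones up
   to [c - s]. *)
pose B := [set t | U t <= c - s] `|`
  ([set t | U t <= 1] `\` [set t | U t <= 1 - s]).
transitivity (pr P B); last first.
  rewrite /B prU//; last 2 first.
  - exact: measurableD.
  - by apply/seteqP; split=> t //= [Ua [_ /negP]]; rewrite -ltNge; lra.
  rewrite Uc; last by apply/andP; split; lra.
  by rewrite prI; lra.
apply: (pr_eq_modulo _ _ (mle 1) U1) => //.
  by apply: measurableU => //; exact: measurableD.
apply/seteqP; split=> t /=.
  rewrite /rotation => -[+ tU]; case: ifPn => [? ?|].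
    by split=> //; left=> /=; lra.
  rewrite -ltNge; case: ifPn => [*|]; first by split=> //; left=> /=; lra.
  by move=> /negP ns aU h; split=> //; right; split.
rewrite /rotation => -[[/= Ua|[/= Uc1 /= Us]] tU]; split=> //.
  by case: ifPn => *; [lra|rewrite ifT; lra].
move/negP: (Us); rewrite -ltNge => Us'.
rewrite ifF; last by apply/negP; lra.
by rewrite ifF; [lra|apply/negP].
Qed.

(* The [n + 1] rotations of [u] by multiples of [h] visit each cell
   [(a + j h, a + (j + 1) h]] exactly once. *)
Lemma rotation_sum_ge (f : R -> R) (a u : R) (n : nat) :
  {homo f : x y / x <= y} -> a < u <= 1 ->
  \sum_(j < n.+1) f (a + j%:R * ((1 - a) / n.+1%:R)) <=
  \sum_(i < n.+1) f (rotation a (i%:R * ((1 - a) / n.+1%:R)) u).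
Proof.
move=> f_nd /andP[au u1]; set h := _ / _.
have h0 : 0 < h by rewrite divr_gt0 ?ltr0Sn//; lra.
have nh : n.+1%:R * h = 1 - a by rewrite /h mulrC divfK// pnatr_eq0.
have exk : exists k, u <= a + k.+1%:R * h by exists n; rewrite nh; lra.
have kn : (ex_minn exk <= n)%N.
  by case: ex_minnP => k _; apply; rewrite nh; lra.
(* The least index in [exk] is that of the cell containing [u]: minimality gives the strict lower
   bound, and [a < u] covers index 0. *)
have [ku uk] : a + (ex_minn exk)%:R * h < u /\ u <= a + (ex_minn exk).+1%:R * h.
  case: ex_minnP => -[|k] uk mink; split=> //; first by rewrite mul0r addr0.
  by rewrite ltNge; apply/negP => /mink; rewrite ltnn.
set k := ex_minn exk in kn ku uk.
(* Addition in ['I_n.+1] is modular, so the left sum is shifted cyclically by [k]; the rotation by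
   [i * h] then puts [u] above the left endpoint of cell [(k + i) %% n.+1], and the sums compare
   term by term. *)
rewrite (reindex_inj (addrI (inord k : 'I_n.+1)))/=.
apply: ler_sum => i _; apply: f_nd.
rewrite inordK ?ltnS//.
have le1 : a + ((k + i) %% n.+1)%:R * h <= a + (k + i)%:R * h.
  by rewrite lerD2l ler_pM2r// ler_nat leq_mod.
rewrite /rotation ifF; last by apply/negP; lra.
case: ifPn => [_|]; first by move: le1; rewrite natrD mulrDl; lra.
rewrite -ltNge => ui.
(* Wrapping past 1 forces the index to overflow, so one full turn [n.+1%:R * h = 1 - a] is removed
   from the point and from its index alike. *)
have nki : (n.+1 <= k + i)%N.
  rewrite -ltnS -(ltr_nat R) -(ltr_pM2r h0 n.+1%:R) nh.
  by rewrite -natr1 natrD; move: uk; rewrite -natr1; lra.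
have : a + ((k + i) %% n.+1)%:R * h <= a + (k + i - n.+1)%:R * h.
  rewrite lerD2l ler_pM2r// ler_nat.
  by rewrite -{1}(subnK nki) modnDr leq_mod.
by rewrite natrB// natrD mulrBl nh; lra.
Qed.

End rotation.

(** * Riemann sums of monotone functions *)

Section riemann_sum.
Context (R : realType).
Local Notation mu := (@lebesgue_measure R).

(** On each cell a nondecreasing function is at most its value at the right endpoint; the cells are
    added one at a time. *)
Lemma integral_le_riemann_sum (f : R -> R) (K a h : R) (n : nat) :
  {homo f : x y / x <= y} -> (forall x, `|f x| <= K) -> 0 <= h ->
  \int[mu]_(u in `]a, a + n%:R * h]) f u <=
  h * \sum_(j < n) f (a + j.+1%:R * h).
Proof.
move=> f_nd fK h0.
have intf x y : mu.-integrable `]x, y] (EFin \o f).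
  apply: (@bounded_fun_integrable _ _ _ _ _ _ K) => //.
    exact: lebesgue_itv_lty.
  exact: nondecreasing_measurable.
elim: n => [|n ih].
  rewrite big_ord0 mulr0 mul0r addr0 set_itv_ge ?Rintegral_set0//.
  by rewrite bnd_simp ltxx.
have nS : a + n%:R * h <= a + n.+1%:R * h by rewrite lerD2l ler_wpM2r// ler_nat.
have := @Rintegral_itvB _ f (BRight a) (BRight (a + n.+1%:R * h)) (a + n%:R * h).
move=> /(_ (intf _ _)); rewrite !bnd_simp nS lerDl mulr_ge0// => /(_ isT isT) E.
rewrite big_ord_recr/= mulrDr -[leLHS](subrK (\int[mu]_(t in `]a, (a + n%:R * h)]) f t)).
rewrite E addrC lerD//.
rewrite [leRHS](_ : _ =
    \int[mu]_(x in `]a + n%:R * h, a + n.+1%:R * h]) f (a + n.+1%:R * h)).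
  apply: le_Rintegral => //.
    by apply: (@bounded_fun_integrable _ _ _ _ _ _ K) => //; exact: lebesgue_itv_lty.
  by move=> x /=; rewrite in_itv/= => /andP[_ /f_nd].
rewrite Rintegral_cst// fine_lebesgue_itv// mulrC; congr (_ * _).
by rewrite -natr1; ring.
Qed.

End riemann_sum.

Section minimality.
Context (R : realType) (d : measure_display) (T : measurableType d)
  (P : probability T R) (hP : atomless P).
Local Notation mu := (@lebesgue_measure R).

Lemma ES_le_of_ge_VaRp a (rho : (T -> R) -> \bar R) : 0 <= a < 1 ->
  ge_on_Linf P rho (VaRp P a) -> quasi_convex P rho -> law_invariant P rho ->
  ge_on_Linf P rho (ES P a).
Proof.
move=> a01 rhoV qc li X LX; have /andP[a0 a1] := a01.
have [mX [M M0 XM]] := Linf_bound LX.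
have [U [mU Uc]] := atomless_uniform hP.
rewrite (ES_quantile M0 mX XM a01); set Q := quantile P M X.
set I := \int[mu]_(b in `]a, 1]) Q b.
have Q_nd : {homo Q : x y / x <= y} by move=> x y; exact: quantile_nd.
have Qn u : `|Q u| <= M by exact: quantile_norm.
have mle x : measurable [set t | U t <= x] by exact: measurable_le_preimage.
(* The error is [h / (1 - a)], that is [n.+1%:R^-1], times the bound [2 * M] on the oscillation of
   [Q]; it vanishes as [n] grows. *)
suff H n : (((1 - a)^-1 * I - 2 * M / n.+1%:R)%:E <= rho X)%E.
  apply/lee_addgt0Pr => e e0.
  have /archi_boundP : 0 <= 2 * M / e by rewrite divr_ge0 ?mulr_ge0// ltW.
  set N := Num.bound _; rewrite ltr_pdivrMr// => hN.
  rewrite -leeBlDr// (le_trans _ (H N))// -EFinB lee_fin lerD2l lerN2.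
  rewrite ler_pdivrMr ?ltr0Sn// -natr1; lra.
pose h := (1 - a) / n.+1%:R.
have nh : n.+1%:R * h = 1 - a by rewrite /h mulrC divfK// pnatr_eq0.
have h0 : 0 <= h by rewrite divr_ge0//; lra.
pose Y i t := Q (rotation a (i%:R * h) (U t)).
have mrU i : measurable_fun setT (fun t => rotation a (i%:R * h) (U t)).
  by apply: measurableT_comp => //; exact: measurable_rotation.
have mY i : measurable_fun setT (Y i).
  by apply: (measurableT_comp _ (mrU i)); exact: measurable_quantile.
have LY i : Linf P (Y i) by apply: (bounded_Linf P (mY i) (K := M)) => t; exact: Qn.
have rhoY i : (i <= n)%N -> (rho (Y i) <= rho X)%E.
  move=> i_n; rewrite (li (Y i) X)// => B mB.
  apply: eq_cdf_law => // x; apply: (quantile_cdf mX M0 XM (mrU i)).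
  apply: rotation_uniform => //; rewrite mulr_ge0//= -nh ler_wpM2r// ler_nat.
  exact: leqW.
have mA := measurable_average n mY.
have YM i t : `|Y i t| <= M by exact: Qn.
apply: (le_trans _ (quasi_convex_average qc mY YM rhoY)).
apply: (le_trans _ (rhoV _ (bounded_Linf P mA (K := M) _))); last first.
  by move=> t; exact: average_norm.
set c := _ - _.
have cZ t : a < U t <= 1 -> c <= average n Y t.
  move=> aU; rewrite /c lerBlDr.
  have := rotation_sum_ge n Q_nd aU; rewrite -/h => rs.
  have := @integral_le_riemann_sum _ Q M a h n.+1 Q_nd Qn h0.
  rewrite nh (_ : a + (1 - a) = 1) -/I; last by ring.
  (* The rotations dominate the sum over left endpoints, whereas the integral is bounded by the sum
     over right endpoints. The two differ by a telescoping term of size at most [2 * M]. *)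
  have -> : \sum_(j < n.+1) Q (a + j.+1%:R * h) =
      \sum_(j < n.+1) Q (a + j%:R * h) + (Q (a + n.+1%:R * h) - Q a).
    rewrite -[LHS](subrK (\sum_(j < n.+1) Q (a + j%:R * h))) addrC; congr (_ + _).
    rewrite -sumrB -(big_mkord xpredT
      (fun j => Q (a + j.+1%:R * h) - Q (a + j%:R * h))).
    by rewrite (telescope_sumr (fun j => Q (a + j%:R * h)))// mul0r addr0.
  move=> hI; rewrite mulrC ler_pdivrMr ?subr_gt0// (le_trans hI)//.
  rewrite [leRHS](_ : _ = h * (\sum_(i < n.+1) Y i t + 2 * M)); last first.
    by rewrite /average /h; ring.
  rewrite ler_wpM2l// lerD//.
  have := Qn a; have := Qn (a + n.+1%:R * h).
  by rewrite !ler_norml => /andP[_ ?] /andP[? _]; lra.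
(* For [x < c], the event that the average is at most [x] lies, up to a null set, inside [U <= a];
   its mass is then at most [a], so [x] is not a candidate in the infimum defining [VaRp]. *)
apply: le_ereal_inf_tmp => _ [x /= + <-]; rewrite lee_fin leNgt => ax.
apply/negP => xc; move: ax; apply/negP; rewrite -leNgt.
have mZ : measurable [set t | average n Y t <= x] by exact: measurable_le_preimage.
rewrite prE// lee_fin.
rewrite -[leRHS](Uc a); last by rewrite a0 (ltW a1).
rewrite (@pr_eq_modulo _ _ _ P _ ([set t | average n Y t <= x] `&` [set t | U t <= 1]) _ mZ _ (mle 1)).
- apply: prS => //; first exact: measurableI.
  move=> t [/= Zx U1]; rewrite leNgt; apply/negP => aU.
  by have := cZ t; rewrite aU U1 => /(_ isT); lra.
- exact: measurableI.
- by rewrite Uc// ler01 lexx.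
- by rewrite -setIA setIid.
Qed.

End minimality.

(** * Left continuity of expected shortfall in the level *)

Section left_continuity.
Context (R : realType) (d : measure_display) (T : measurableType d)
  (P : probability T R).
Local Notation mu := (@lebesgue_measure R).

(** Lowering the level by [dl] decreases the tail integral by at most [M * dl] and lengthens the
    averaging interval by [dl]; both effects are controlled by the bound [M]. *)
Lemma ES_left_continuous a (X : T -> R) (e : R) : Linf P X -> 0 < a < 1 ->
  0 < e -> exists2 b, 0 <= b < a & (ES P a X <= ES P b X + e%:E)%E.
Proof.
move=> /Linf_bound[mX [M M0 XM]] /andP[a0 a1] e0.
have D0 : 0 < 2 * M + 1 by lra.
(* The final estimate asks for [2 * M * dl <= e * (1 - a)]. The extra 1 keeps the denominator
   positive when [M] is 0, and the minimum with [a] keeps the new level nonnegative. *)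
pose dl := Num.min a (e * (1 - a) / (2 * M + 1)).
have dl0 : 0 < dl.
  by rewrite lt_min a0/= divr_gt0// mulr_gt0// subr_gt0.
have dla : dl <= a by rewrite ge_min lexx.
have dle : dl * (2 * M + 1) <= e * (1 - a).
  by rewrite -ler_pdivlMr// ge_min lexx orbT.
exists (a - dl); first by apply/andP; split; lra.
rewrite !(ES_quantile M0 mX XM); try by apply/andP; split; lra.
set Q := quantile P M X; set b := a - dl.
have Qn u : `|Q u| <= M by exact: quantile_norm.
have ba : b <= a by rewrite /b; lra.
have intQ x y : mu.-integrable `]x, y] (EFin \o Q).
  apply: (@bounded_fun_integrable _ _ _ _ _ _ M) => //; first exact: lebesgue_itv_lty.
  exact: measurable_quantile.
have intc x y (c : R) : mu.-integrable `]x, y] (EFin \o (fun=> c)).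
  by apply: (@bounded_fun_integrable _ _ _ _ _ _ `|c|) => //; exact: lebesgue_itv_lty.
have := @Rintegral_itvB _ Q (BRight b) (BRight 1) a (intQ _ _).
rewrite !bnd_simp => /(_ ba (ltW a1)).
have JM : \int[mu]_(u in `]a, 1]) Q u <= M * (1 - a).
  rewrite -(fine_lebesgue_itv (ltW a1)) -Rintegral_cst//; apply: le_Rintegral => //.
  by move=> u _; have := Qn u; rewrite ler_norml => /andP[].
have IbaM : - M * (a - b) <= \int[mu]_(u in `]b, a]) Q u.
  rewrite -(fine_lebesgue_itv ba) -Rintegral_cst//; apply: le_Rintegral => //.
  by move=> u _; have := Qn u; rewrite ler_norml => /andP[].
move: JM IbaM; move: (\int[mu]_(u in `]a, 1]) Q u) => J.
move: (\int[mu]_(u in `]b, a]) Q u) => Iba; move: (\int[mu]_(u in `]b, 1]) Q u) => I.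
move=> JM IbaM IJ; rewrite -EFinD lee_fin.
have a1' : 0 < 1 - a by rewrite subr_gt0.
have b1' : 0 < 1 - b by rewrite subr_gt0 (le_lt_trans ba).
set L := (1 - a)^-1 * J.
have JL : J = (1 - a) * L by rewrite /L mulrA mulfV ?mul1r// gt_eqF.
have LM : L <= M by move: JM; rewrite JL mulrC ler_pM2r.
rewrite -lerBlDr mulrC ler_pdivlMr//.
have -> : I = J + Iba by rewrite -IJ subrK.
rewrite JL; move: IbaM; rewrite /b; nra.
Qed.

Lemma VaRp_le_VaR b a (X : T -> R) : b < a -> (VaRp P b X <= VaR P a X)%E.
Proof.
move=> ba; apply: ereal_inf_le_tmp => _ [x /= ax <-]; exists x => //=.
by rewrite (lt_le_trans _ ax)// lte_fin.
Qed.

End left_continuity.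

Theorem theorem1 (R : realType) (d : measure_display) (T : measurableType d)
  (P : probability T R) (hP : atomless P) :
  (forall a : R, 0 < a <= 1 -> is_min_QLI_above P (VaR P a) (ES P a)) /\
  (forall a : R, 0 <= a < 1 -> is_min_QLI_above P (VaRp P a) (ES P a)).
Proof.
split=> a /andP[a0 a1].
- have a01 : 0 <= a <= 1 by rewrite (ltW a0).
  split.
    split; last by split; [exact: ES_quasi_convex|exact: ES_law_invariant].
    move=> X LX; have [lt_a1|ge_a1] := ltP a 1.
      rewrite (le_trans (VaR_le_VaRp _ _ _))// ES_ge_VaRp//.
      by rewrite (ltW a0).
    have -> : a = 1 by apply/eqP; rewrite eq_le a1.
    by rewrite /ES ltxx.
  (* At level 1 [ES] is [VaR] by definition, so the domination hypothesis is already the conclusion;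
     only levels below 1 need the approximation by smaller levels. *)
  move=> rho rhoV qc li X LX; have [lt_a1|ge_a1] := ltP a 1; last first.
    have a1' : a = 1 by apply/eqP; rewrite eq_le a1.
    by have := rhoV X LX; rewrite a1' /ES ltxx.
  apply/lee_addgt0Pr => e e0.
  have [|b /andP[b0 ba] ESb] := @ES_left_continuous _ _ _ P a X e LX _ e0.
    by rewrite a0.
  rewrite (le_trans ESb)// leeD2r//.
  apply: (ES_le_of_ge_VaRp hP _ _ qc li) => //.
    by rewrite b0 (lt_trans ba).
  by move=> Y LY; rewrite (le_trans (VaRp_le_VaR _ _ ba))// rhoV.
- have a01 : 0 <= a < 1 by rewrite a0.
  split; last by move=> rho; exact: ES_le_of_ge_VaRp.
  split; first exact: ES_ge_VaRp.
  by split; [apply: ES_quasi_convex; rewrite a0 ltW|exact: ES_law_invariant].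
Qed.
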